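(* Let $\mathcal D$ be a commutative variety of algebras or ordered algebras, $X,Y\in\mathcal D$, and let $L:X^*\to Y$ be a language. Then the syntactic $\mathcal D$-monoid of $L$ is isomorphic to the transition $\mathcal D$-monoid of the minimal $\mathcal D$-automaton for $L$: $\mathrm{Syn}(L)\cong T(\mathrm{Min}(L))$.
   Context: A commutative variety $\mathcal D$ is a variety of (ordered) $\Sigma$-algebras such that for all $A,B$ the set $[A,B]$ of homomorphisms is a subalgebra of $B^{|A|}$. $A\otimes B$ represents bimorphisms (maps that are homomorphisms in each variable); $I$ is the free algebra on one generator; elements of $A$ are identified with morphisms $I\to A$. A $\mathcal D$-monoid is an object with a monoid structure $(\bullet,1)$ whose multiplication is a bimorphism; $X^*$ is the free $\mathcal D$-monoid on $X$; a language is a morphism $X^*\to Y$. A $\mathcal D$-automaton $(Q,\delta,i,f)$: object $Q$, morphisms $\delta:X\otimes Q\to Q$, $i:I\to Q$, $f:Q\to Y$. $[Q,Q]$ is a $\mathcal D$-monoid under composition; $(\lambda\delta)^+:X^*\to[Q,Q]$ is the unique $\mathcal D$-monoid morphism extending the curried $\lambda\delta$; $\delta_x=(\lambda\delta)^+(x)$. Accepted language: $x\mapsto f(\delta_x(i))$. The automaton is reachable if $x\mapsto\delta_x(i)$ is surjective $|X^*|\to|Q|$, simple if $q\mapsto(x\mapsto f(\delta_x(q)))$ is injective from $|Q|$ to the set of morphisms $X^*\to Y$, minimal if both. Every language $L$ is accepted by a minimal automaton $\mathrm{Min}(L)$, unique up to isomorphism. The transition $\mathcal D$-monoid $T(Q)$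 is the image of $(\lambda\delta)^+$ (surjective $\mathcal D$-monoid morphism $X^*\to T(Q)$ followed by an injective, resp. order-reflecting, one into $[Q,Q]$). A $\mathcal D$-monoid morphism $e:X^*\to M$ recognizes $L$ if $L=g\circ e$ for some morphism $g$; an $X$-generated $\mathcal D$-monoid is a surjective $\mathcal D$-monoid morphism from $X^*$; $e_1\le e_2$ iff $e_1=h\circ e_2$ for a $\mathcal D$-monoid morphism $h$; $\mathrm{Syn}(L)$ is the $X$-generated $\mathcal D$-monoid recognizing $L$ that is $\le$ all others recognizing $L$.
   Formalization: For ordered algebras, ''simple'' is taken to mean that the map from states to languages is injective and order-reflecting; with mere injectivity the minimal automaton is not unique and the claim fails (e.g. posets, L = a⁺, discretely ordered states). *)

(* Defs.v *)
Set Warnings "-notation-overridden".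
From mathcomp Require Import all_boot.
From mathcomp Require Import boolp.

Set Implicit Arguments.
Unset Strict Implicit.
Unset Printing Implicit Defensive.

(* Varieties of algebras and varieties of ordered algebras are treated         *)
(* uniformly: every algebra carries a partial order for which the operations   *)
(* are monotone, and in the unordered case this order is required to be        *)
(* equality.  In that case inequations are equations, monotonicity is void and *)
(* the pointwise orders below are again equality.                              *)

Record signature := Signature { sop : Type; arity : sop -> nat }.

Inductive term (S : signature) (V : Type) : Type :=
| Var of V
| App (o : sop S) of ('I_(arity o) -> term S V).

Definition raw_ops (S : signature) (T : Type) : Type :=
  forall o : sop S, ('I_(arity o) -> T) -> T.

Fixpoint eval (S : signature) (V T : Type) (ops : raw_ops S T) (v : V -> T)
    (t : term S V) : T :=
  match t with
  | Var x => v x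
  | App o a => ops o (fun i => eval ops v (a i))
  end.

Inductive kind := Unordered | Ordered.

(* [vax s t] is the equation s = t in the unordered case and the inequation    *)
(* s <= t in the ordered case.                                                 *)
Record variety := Variety {
  vkind : kind;
  vsig : signature;
  vax : term vsig nat -> term vsig nat -> Prop
}.

Record algebra (D : variety) := Algebra {
  carrier :> Type;
  op : raw_ops (vsig D) carrier;
  le : carrier -> carrier -> Prop;
  le_refl : forall x, le x x;
  le_trans : forall x y z, le x y -> le y z -> le x z;
  le_anti : forall x y, le x y -> le y x -> x = y;
  le_discrete : vkind D = Unordered -> forall x y, le x y -> x = y;
  op_mono : forall o a b, (forall i, le (a i) (b i)) -> le (@op o a) (@op o b);
  op_sat : forall s t, vax s t ->
             forall v : nat -> carrier, le (eval op v s) (eval op v t)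
}.
Arguments op {D a} o _ : rename.
Arguments le {D a} _ _ : rename.

Definition is_hom (D : variety) (A B : algebra D) (f : A -> B) : Prop :=
  (forall x y, le x y -> le (f x) (f y)) /\
  (forall o (a : 'I_(arity o) -> A), f (op o a) = op o (fun i => f (a i))).

Record hom (D : variety) (A B : algebra D) := Hom {
  hfun :> A -> B;
  homP : is_hom hfun
}.

Lemma hom_ext D (A B : algebra D) (f g : hom A B) :
  (forall x, f x = g x) -> f = g.
Proof.
case: f g => [f pf] [g pg] /= /funext fg; case: _ / fg in pg *.
by rewrite (Prop_irrelevance pf pg).
Qed.

Lemma comp_is_hom D (A B C : algebra D) (g : hom B C) (f : hom A B) :
  is_hom (fun x => g (f x)).
Proof.
have [[gm go] [fm fo]] := (homP g, homP f).
by split=> [x y /fm/gm|o a] //; rewrite fo go.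
Qed.
Definition hcomp D (A B C : algebra D) (g : hom B C) (f : hom A B) : hom A C :=
  Hom (comp_is_hom g f).

(* The monos of the factorization system of the category of algebras.          *)
Definition embedding (D : variety) (A B : algebra D) (f : A -> B) : Prop :=
  injective f /\
  (vkind D = Ordered -> forall x y, le (f x) (f y) -> le x y).

Definition surj (A B : Type) (f : A -> B) : Prop := forall y, exists x, f x = y.

(* Operations on [hom A B] are pointwise, i.e. those of the power B^|A|.       *)
Definition commutative_variety (D : variety) : Prop :=
  forall (A B : algebra D) (o : sop (vsig D)) (h : 'I_(arity o) -> hom A B),
    is_hom (fun x => op o (fun i => h i x)).

Record comm_variety := CommVariety {
  cvar :> variety;
  cvarP : commutative_variety cvar
}.

Lemma eval_morph (S : signature) (V T U : Type) (ops : raw_ops S T)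
    (ops' : raw_ops S U) (h : T -> U) (v : V -> T) (t : term S V) :
  (forall o a, h (ops o a) = ops' o (fun i => h (a i))) ->
  h (eval ops v t) = eval ops' (fun x => h (v x)) t.
Proof.
move=> hh; elim: t => [x|o a IH] //=; rewrite hh.
by congr (ops' o _); apply: funext => i; apply: IH.
Qed.

(* Quotient of a preordered model by the equivalence induced by its preorder.  *)
Record prealgebra (D : variety) := PreAlgebra {
  pcarrier :> Type;
  pop : raw_ops (vsig D) pcarrier;
  ple : pcarrier -> pcarrier -> Prop;
  ple_refl : forall x, ple x x;
  ple_trans : forall x y z, ple x y -> ple y z -> ple x z;
  ple_sym : vkind D = Unordered -> forall x y, ple x y -> ple y x;
  pop_mono : forall o a b, (forall i, ple (a i) (b i)) -> ple (@pop o a) (@pop o b);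
  pop_sat : forall s t, vax s t ->
             forall v : nat -> pcarrier, ple (eval pop v s) (eval pop v t)
}.
Arguments pop {D p} o _ : rename.
Arguments ple {D p} _ _ : rename.

Section Quotient.
Variables (D : variety) (P : prealgebra D).

Definition quot : Type :=
  {C : P -> Prop | exists t, C = (fun u => ple t u /\ ple u t)}.
Definition cls (t : P) : quot := exist _ _ (ex_intro _ t erefl).
Definition repr (q : quot) : P := sval (cid (svalP q)).

Lemma cls_eq s t : ple s t -> ple t s -> cls s = cls t.
Proof.
move=> st ts; apply: eq_exist; apply: funext => u; apply: propext.
by split=> -[h1 h2]; split; eapply ple_trans; eassumption.
Qed.

Lemma repr_cls t : ple t (repr (cls t)) /\ ple (repr (cls t)) t.
Proof.
rewrite /repr; case: cid => u /= E.
by move/(congr1 (fun C => C u)): E => ->; split; apply: ple_refl.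
Qed.

Lemma cls_repr q : cls (repr q) = q.
Proof.
case: q => C [t E]; rewrite -(_ : cls t = exist _ C (ex_intro _ t E)).
  by have [h1 h2] := repr_cls t; apply: cls_eq.
by apply: eq_exist.
Qed.

Definition qop : raw_ops (vsig D) quot :=
  fun o a => cls (pop o (fun i => repr (a i))).
Definition qle (p q : quot) : Prop := ple (repr p) (repr q).

Lemma qle_cls s t : qle (cls s) (cls t) <-> ple s t.
Proof.
have [[h1 h2] [h3 h4]] := (repr_cls s, repr_cls t); split=> h.
  exact: ple_trans h1 (ple_trans h h4).
exact: ple_trans h2 (ple_trans h h3).
Qed.

Lemma qop_cls o (a : 'I_(arity o) -> P) :
  qop (fun i => cls (a i)) = cls (pop o a).
Proof. by apply: cls_eq; apply: pop_mono => i; have [] := repr_cls (a i). Qed.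

Lemma qle_refl q : qle q q. Proof. exact: ple_refl. Qed.
Lemma qle_trans p q r : qle p q -> qle q r -> qle p r.
Proof. exact: ple_trans. Qed.
Lemma qle_anti p q : qle p q -> qle q p -> p = q.
Proof. by move=> h1 h2; rewrite -(cls_repr p) -(cls_repr q); apply: cls_eq. Qed.
Lemma qle_discrete : vkind D = Unordered -> forall p q, qle p q -> p = q.
Proof. by move=> k p q h; apply: qle_anti => //; apply: ple_sym. Qed.
Lemma qop_mono o (a b : 'I_(arity o) -> quot) :
  (forall i, qle (a i) (b i)) -> qle (qop a) (qop b).
Proof. by move=> h; apply/qle_cls; apply: pop_mono. Qed.
Lemma qop_sat s t : vax s t ->
  forall v : nat -> quot, qle (eval qop v s) (eval qop v t).
Proof.
move=> st v; have E u : eval qop v u = cls (eval (@pop D P) (fun x => repr (v x)) u).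
  rewrite (eval_morph (h := cls) (ops' := qop)); last by move=> o a; rewrite qop_cls.
  by congr (eval qop _ u); apply: funext => x; rewrite cls_repr.
by rewrite !E; apply/qle_cls; apply: pop_sat.
Qed.

Definition quotient : algebra D :=
  Algebra qle_refl qle_trans qle_anti qle_discrete qop_mono qop_sat.

Section Lift.
Variables (A : algebra D) (k : P -> A).
Hypothesis k_op : forall o (a : 'I_(arity o) -> P), k (pop o a) = op o (fun i => k (a i)).
Hypothesis k_mono : forall s t, ple s t -> le (k s) (k t).

Lemma lift_cls t : k (repr (cls t)) = k t.
Proof. by have [h1 h2] := repr_cls t; apply: le_anti; apply: k_mono. Qed.

Lemma lift_is_hom : is_hom (A := quotient) (fun q => k (repr q)).
Proof.
split=> [p q h|o a]; first exact: k_mono.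
by rewrite [op o a]/(qop a) /qop lift_cls k_op.
Qed.
Definition qlift : hom quotient A := Hom lift_is_hom.
End Lift.
End Quotient.
Arguments cls {D P} t.

(* The algebra presented by generators V and relations R.                      *)
Section Presentation.
Variables (D : variety) (V : Type).
Variable R : term (vsig D) V -> term (vsig D) V -> Prop.

Inductive pres_le : term (vsig D) V -> term (vsig D) V -> Prop :=
| pres_refl s : pres_le s s
| pres_trans s t u : pres_le s t -> pres_le t u -> pres_le s u
| pres_sym : vkind D = Unordered -> forall s t, pres_le s t -> pres_le t s
| pres_cong o a b : (forall i, pres_le (a i) (b i)) ->
    pres_le (@App (vsig D) V o a) (@App (vsig D) V o b)
| pres_ax s t : vax s t -> forall v : nat -> term (vsig D) V,
    pres_le (eval (@App (vsig D) V) v s) (eval (@App (vsig D) V) v t)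
| pres_rel s t : R s t -> pres_le s t.

Definition pres_pre : prealgebra D :=
  PreAlgebra pres_refl pres_trans pres_sym pres_cong pres_ax.

Definition pres : algebra D := quotient pres_pre.

Definition gen (x : V) : pres := cls (P := pres_pre) (Var (vsig D) x).

Section PresLift.
Variables (A : algebra D) (v : V -> A).
Hypothesis vR : forall s t, R s t -> le (eval (@op D A) v s) (eval (@op D A) v t).

Lemma pres_eval_mono s t :
  pres_le s t -> le (eval (@op D A) v s) (eval (@op D A) v t).
Proof.
elim=> {s t} [s|s t u _ h1 _ h2|k s t _ /(le_discrete k) ->|o a b _ h|s t st w|s t /vR] //.
- exact: le_refl.
- exact: le_trans h1 h2.
- exact: le_refl.
- exact: op_mono.
- by rewrite !(eval_morph (h := eval (@op D A) v) (ops' := @op D A)) //; apply: op_sat.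
Qed.

Definition pres_lift : hom pres A :=
  qlift (P := pres_pre) (k := eval (@op D A) v) (fun o a => erefl) pres_eval_mono.

Lemma pres_lift_gen x : pres_lift (gen x) = v x.
Proof. exact: (@lift_cls D pres_pre A (eval (@op D A) v) pres_eval_mono). Qed.
End PresLift.

Lemma pres_hom_ext (A : algebra D) (f g : hom pres A) :
  (forall x, f (gen x) = g (gen x)) -> f = g.
Proof.
move=> fg; apply: hom_ext => q.
rewrite -(cls_repr q); elim: (repr q) => [x|o a IH]; first exact: fg.
rewrite -(@qop_cls D pres_pre o a).
rewrite (proj2 (homP f) o _) (proj2 (homP g) o _).
by congr (op o _); apply: funext => i; apply: IH.
Qed.
End Presentation.

Definition unit_alg (D : variety) : algebra D :=
  pres (D := D) (V := unit) (fun _ _ => False).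

(* The element of A named by a morphism I -> A.                                *)
Definition elem (D : variety) (A : algebra D) (i : hom (unit_alg D) A) : A :=
  i (gen _ tt).

Lemma elem_bij (D : variety) (A : algebra D) (a : A) :
  exists! i : hom (unit_alg D) A, elem i = a.
Proof.
exists (pres_lift (v := fun _ => a) (fun s t => False_ind _)); split.
  exact: pres_lift_gen.
by move=> i ia; apply: pres_hom_ext => -[]; rewrite pres_lift_gen.
Qed.

Definition bimorphism (D : variety) (A B C : algebra D) (f : A -> B -> C) : Prop :=
  (forall a, is_hom (f a)) /\ (forall b, is_hom (fun a => f a b)).

Section Tensor.
Variables (D : variety) (A B : algebra D).
Let T := term (vsig D) (A * B).
Let V (a : A) (b : B) : T := Var (vsig D) (a, b).

Inductive tensor_rel : T -> T -> Prop :=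
| tensor_lel a a' b : le a a' -> tensor_rel (V a b) (V a' b)
| tensor_ler a b b' : le b b' -> tensor_rel (V a b) (V a b')
| tensor_opl1 o a b : tensor_rel (V (op o a) b) (App (fun i => V (a i) b))
| tensor_opl2 o a b : tensor_rel (App (fun i => V (a i) b)) (V (op o a) b)
| tensor_opr1 o a b : tensor_rel (V a (op o b)) (App (fun i => V a (b i)))
| tensor_opr2 o a b : tensor_rel (App (fun i => V a (b i))) (V a (op o b)).

Definition tensor : algebra D := pres tensor_rel.
Definition tens (a : A) (b : B) : tensor := gen tensor_rel (a, b).

Lemma tens_bimorphism : bimorphism tens.
Proof.
have opE o (c : 'I_(arity o) -> A * B) :
    op (a := tensor) o (fun i => gen tensor_rel (c i)) =
    cls (P := pres_pre tensor_rel) (App (fun i => Var (vsig D) (c i))).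
  exact: qop_cls.
split=> [a|b]; split.
- by move=> x y xy; apply/qle_cls; apply: pres_rel; apply: tensor_ler.
- move=> o x; rewrite (opE o (fun i => (a, x i))).
  by apply: cls_eq; apply: pres_rel; [apply: tensor_opr1|apply: tensor_opr2].
- by move=> x y xy; apply/qle_cls; apply: pres_rel; apply: tensor_lel.
- move=> o x; rewrite (opE o (fun i => (x i, b))).
  by apply: cls_eq; apply: pres_rel; [apply: tensor_opl1|apply: tensor_opl2].
Qed.

Lemma tensor_universal (C : algebra D) (f : A -> B -> C) : bimorphism f ->
  exists! h : hom tensor C, forall a b, h (tens a b) = f a b.
Proof.
move=> [fr fl]; pose v (p : A * B) := f p.1 p.2.
have vR s t : tensor_rel s t -> le (eval (@op D C) v s) (eval (@op D C) v t).
  case=> /= [a a' b|a b b'|o a b|o a b|o a b|o a b].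
  - exact: (proj1 (fl b)).
  - exact: (proj1 (fr a)).
  - rewrite /v /= (proj2 (fl b)); exact: le_refl.
  - rewrite /v /= (proj2 (fl b)); exact: le_refl.
  - rewrite /v /= (proj2 (fr a)); exact: le_refl.
  - rewrite /v /= (proj2 (fr a)); exact: le_refl.
exists (pres_lift vR); split; first by move=> a b; apply: pres_lift_gen.
move=> h hE; apply: pres_hom_ext => -[a b].
by rewrite pres_lift_gen; rewrite -[gen _ _]/(tens a b) hE.
Qed.
End Tensor.

Section InternalHom.
Variable D : comm_variety.

Section Object.
Variables A B : algebra D.

Definition ihom_op : raw_ops (vsig D) (hom A B) := fun o h => Hom (cvarP h).
Definition ihom_le (f g : hom A B) : Prop := forall x, le (f x) (g x).

Lemma ihom_le_refl f : ihom_le f f. Proof. by move=> x; apply: le_refl. Qed.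
Lemma ihom_le_trans f g h : ihom_le f g -> ihom_le g h -> ihom_le f h.
Proof. by move=> fg gh x; apply: le_trans (fg x) (gh x). Qed.
Lemma ihom_le_anti f g : ihom_le f g -> ihom_le g f -> f = g.
Proof. by move=> fg gf; apply: hom_ext => x; apply: le_anti. Qed.
Lemma ihom_le_discrete : vkind D = Unordered -> forall f g, ihom_le f g -> f = g.
Proof. by move=> k f g fg; apply: hom_ext => x; apply: le_discrete. Qed.
Lemma ihom_op_mono o (a b : 'I_(arity o) -> hom A B) :
  (forall i, ihom_le (a i) (b i)) -> ihom_le (ihom_op a) (ihom_op b).
Proof. by move=> h x; apply: op_mono => i; apply: h. Qed.
Lemma ihom_op_sat s t : vax s t ->
  forall v : nat -> hom A B, ihom_le (eval ihom_op v s) (eval ihom_op v t).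
Proof.
move=> st v x.
by rewrite !(eval_morph (h := fun f : hom A B => f x) (ops' := @op D B)) //; apply: op_sat.
Qed.

Definition ihom : algebra D :=
  Algebra ihom_le_refl ihom_le_trans ihom_le_anti ihom_le_discrete
          ihom_op_mono ihom_op_sat.

Lemma ev_is_hom (a : A) : is_hom (A := ihom) (fun f : hom A B => f a).
Proof. by split=> // f g; apply. Qed.
Definition ev (a : A) : hom ihom B := Hom (ev_is_hom a).
End Object.

Section Curry.
Variables (A B C : algebra D) (d : hom (tensor A B) C).

Lemma curry_is_homr a : is_hom (fun b => d (tens a b)).
Proof. exact: (comp_is_hom d (Hom (proj1 (tens_bimorphism A B) a))). Qed.

Lemma curry_is_hom : is_hom (B := ihom B C) (fun a => Hom (curry_is_homr a)).
Proof.
split=> [a a' aa' b|o a].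
  exact: (proj1 (comp_is_hom d (Hom (proj2 (tens_bimorphism A B) b)))).
apply: hom_ext => b.
exact: (proj2 (comp_is_hom d (Hom (proj2 (tens_bimorphism A B) b)))).
Qed.
Definition curry : hom A (ihom B C) := Hom curry_is_hom.
End Curry.
End InternalHom.

Record dmonoid (D : comm_variety) := DMonoid {
  mobj :> algebra D;
  mone : mobj;
  mmul : mobj -> mobj -> mobj;
  mmul_bimorphism : bimorphism mmul;
  mmulA : forall x y z, mmul x (mmul y z) = mmul (mmul x y) z;
  mmul1l : forall x, mmul mone x = x;
  mmul1r : forall x, mmul x mone = x
}.
Arguments mone {D d} : rename.
Arguments mmul {D d} _ _ : rename.

Record mhom (D : comm_variety) (M N : dmonoid D) := MHom {
  mhom_hom :> hom M N;
  mhom1 : mhom_hom mone = mone;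
  mhomM : forall x y, mhom_hom (mmul x y) = mmul (mhom_hom x) (mhom_hom y)
}.

Lemma mhom_ext (D : comm_variety) (M N : dmonoid D) (f g : mhom M N) :
  (forall x, f x = g x) -> f = g.
Proof.
case: f g => [f f1 fM] [g g1 gM] /= /hom_ext E; case: _ / E in g1 gM *.
by rewrite (Prop_irrelevance f1 g1) (Prop_irrelevance fM gM).
Qed.

Definition mon_iso (D : comm_variety) (M N : dmonoid D) : Prop :=
  exists (f : mhom M N) (g : mhom N M), cancel f g /\ cancel g f.

Section Endo.
Variables (D : comm_variety) (Q : algebra D).

Lemma id_is_hom : is_hom (fun x : Q => x). Proof. by []. Qed.

Lemma endo_bimorphism :
  bimorphism (A := ihom Q Q) (B := ihom Q Q) (C := ihom Q Q) (@hcomp D Q Q Q).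
Proof.
split=> f; split=> [g h gh x|o a].
- exact: (proj1 (homP f)).
- by apply: hom_ext => x /=; rewrite (proj2 (homP f)).
- exact: gh.
- exact: hom_ext.
Qed.

Lemma endoA (f g h : hom Q Q) : hcomp f (hcomp g h) = hcomp (hcomp f g) h.
Proof. exact: hom_ext. Qed.
Lemma endo1l (f : hom Q Q) : hcomp (Hom id_is_hom) f = f.
Proof. exact: hom_ext. Qed.
Lemma endo1r (f : hom Q Q) : hcomp f (Hom id_is_hom) = f.
Proof. exact: hom_ext. Qed.

Definition endo : dmonoid D :=
  @DMonoid D (ihom Q Q) (Hom id_is_hom) _ endo_bimorphism endoA endo1l endo1r.
End Endo.

(* The free D-monoid X^*: monoid terms over X modulo the least compatible      *)
(* preorder that satisfies the axioms of D, the monoid laws and bilinearity of *)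
(* the multiplication, and makes the insertion of X a morphism.                *)
Section FreeMonoid.
Variables (D : comm_variety) (X : algebra D).

Inductive mterm : Type :=
| MGen of X
| MOp (o : sop (vsig D)) of ('I_(arity o) -> mterm)
| MOne
| MMul of mterm & mterm.

Inductive mle : mterm -> mterm -> Prop :=
| mle_refl s : mle s s
| mle_trans s t u : mle s t -> mle t u -> mle s u
| mle_sym : vkind D = Unordered -> forall s t, mle s t -> mle t s
| mle_op o a b : (forall i, mle (a i) (b i)) -> mle (@MOp o a) (@MOp o b)
| mle_mul s s' t t' : mle s s' -> mle t t' -> mle (MMul s t) (MMul s' t')
| mle_ax s t : vax s t ->
    forall v : nat -> mterm, mle (eval MOp v s) (eval MOp v t)
| mle_A1 s t u : mle (MMul s (MMul t u)) (MMul (MMul s t) u)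
| mle_A2 s t u : mle (MMul (MMul s t) u) (MMul s (MMul t u))
| mle_1l1 s : mle (MMul MOne s) s
| mle_1l2 s : mle s (MMul MOne s)
| mle_1r1 s : mle (MMul s MOne) s
| mle_1r2 s : mle s (MMul s MOne)
| mle_bil1 o a t : mle (MMul (@MOp o a) t) (MOp (fun i => MMul (a i) t))
| mle_bil2 o a t : mle (MOp (fun i => MMul (a i) t)) (MMul (@MOp o a) t)
| mle_bir1 o s a : mle (MMul s (@MOp o a)) (MOp (fun i => MMul s (a i)))
| mle_bir2 o s a : mle (MOp (fun i => MMul s (a i))) (MMul s (@MOp o a))
| mle_gen x y : le x y -> mle (MGen x) (MGen y)
| mle_genop1 o a : mle (MGen (op o a)) (MOp (fun i => MGen (a i)))
| mle_genop2 o a : mle (MOp (fun i => MGen (a i))) (MGen (op o a)).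

Definition free_pre : prealgebra D :=
  PreAlgebra mle_refl mle_trans mle_sym mle_op mle_ax.

Definition free_obj : algebra D := quotient free_pre.
Definition mcls (s : mterm) : free_obj := cls (P := free_pre) s.
Definition free_one : free_obj := mcls MOne.
Definition free_mul (p q : free_obj) : free_obj := mcls (MMul (repr p) (repr q)).

Lemma free_mul_cls s t : free_mul (mcls s) (mcls t) = mcls (MMul s t).
Proof.
have [[h1 h2] [h3 h4]] := (repr_cls (P := free_pre) s, repr_cls (P := free_pre) t).
by apply: cls_eq; apply: mle_mul.
Qed.

Lemma mclsP (q : free_obj) : exists s, q = mcls s.
Proof. by exists (repr q); rewrite /mcls cls_repr. Qed.

Lemma mcls_fam n (a : 'I_n -> free_obj) :
  exists s : 'I_n -> mterm, a = fun i => mcls (s i).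
Proof.
by exists (fun i => repr (a i)); apply: funext => i; rewrite /mcls cls_repr.
Qed.

Lemma free_op_cls o (a : 'I_(arity o) -> mterm) :
  op (a := free_obj) o (fun i => mcls (a i)) = mcls (MOp a).
Proof. exact: (qop_cls (P := free_pre)). Qed.

Lemma free_mul_bimorphism : bimorphism free_mul.
Proof.
split=> p; split.
- by move=> x y xy; apply/qle_cls; apply: mle_mul => //; apply: mle_refl.
- move=> o a; have [s ->] := mclsP p; have [b ->] := mcls_fam a.
  rewrite free_op_cls free_mul_cls.
  under eq_fun => i do rewrite free_mul_cls.
  by rewrite free_op_cls; apply: cls_eq; [apply: mle_bir1|apply: mle_bir2].
- by move=> x y xy; apply/qle_cls; apply: mle_mul => //; apply: mle_refl.
- move=> o a; have [s ->] := mclsP p; have [b ->] := mcls_fam a.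
  rewrite free_op_cls free_mul_cls.
  under eq_fun => i do rewrite free_mul_cls.
  by rewrite free_op_cls; apply: cls_eq; [apply: mle_bil1|apply: mle_bil2].
Qed.

Lemma free_mulA p q r : free_mul p (free_mul q r) = free_mul (free_mul p q) r.
Proof.
have [[s ->] [t ->] [u ->]] := And3 (mclsP p) (mclsP q) (mclsP r).
by rewrite !free_mul_cls; apply: cls_eq; [apply: mle_A1|apply: mle_A2].
Qed.
Lemma free_mul1l p : free_mul free_one p = p.
Proof.
have [s ->] := mclsP p.
by rewrite free_mul_cls; apply: cls_eq; [apply: mle_1l1|apply: mle_1l2].
Qed.
Lemma free_mul1r p : free_mul p free_one = p.
Proof.
have [s ->] := mclsP p.
by rewrite free_mul_cls; apply: cls_eq; [apply: mle_1r1|apply: mle_1r2].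
Qed.

Definition free_monoid : dmonoid D :=
  DMonoid free_mul_bimorphism free_mulA free_mul1l free_mul1r.

Lemma free_unit_is_hom : is_hom (B := free_monoid) (fun x => mcls (MGen x)).
Proof.
split=> [x y xy|o a]; first by apply/qle_cls; apply: mle_gen.
rewrite [RHS]free_op_cls.
by apply: cls_eq; [apply: mle_genop1|apply: mle_genop2].
Qed.
Definition free_unit : hom X free_monoid := Hom free_unit_is_hom.

Section Extend.
Variables (M : dmonoid D) (h : hom X M).

Fixpoint meval (s : mterm) : M :=
  match s with
  | MGen x => h x
  | MOp o a => op o (fun i => meval (a i))
  | MOne => mone
  | MMul s t => mmul (meval s) (meval t)
  end.

Lemma meval_mono s t : mle s t -> le (meval s) (meval t).
Proof.
have [mr ml] := mmul_bimorphism M; have [hm ho] := homP h.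
elim=> {s t} /=.
- by move=> s; apply: le_refl.
- by move=> s t u _ st _ tu; apply: le_trans st tu.
- by move=> k s t _ /(le_discrete k) ->; apply: le_refl.
- by move=> o a b _ ab; apply: op_mono.
- move=> s s' t t' _ ss' _ tt'.
  exact: le_trans (proj1 (ml _) _ _ ss') (proj1 (mr _) _ _ tt').
- move=> s t st v.
  by rewrite !(eval_morph (h := meval) (ops' := @op D M)) //; apply: op_sat.
- by move=> s t u; rewrite mmulA; apply: le_refl.
- by move=> s t u; rewrite mmulA; apply: le_refl.
- by move=> s; rewrite mmul1l; apply: le_refl.
- by move=> s; rewrite mmul1l; apply: le_refl.
- by move=> s; rewrite mmul1r; apply: le_refl.
- by move=> s; rewrite mmul1r; apply: le_refl.
- by move=> o a t; rewrite (proj2 (ml _)); apply: le_refl.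
- by move=> o a t; rewrite (proj2 (ml _)); apply: le_refl.
- by move=> o s a; rewrite (proj2 (mr _)); apply: le_refl.
- by move=> o s a; rewrite (proj2 (mr _)); apply: le_refl.
- by move=> x y; apply: hm.
- by move=> o a; rewrite ho; apply: le_refl.
- by move=> o a; rewrite ho; apply: le_refl.
Qed.

Definition extend_hom : hom free_monoid M :=
  qlift (P := free_pre) (k := meval) (fun o a => erefl) meval_mono.

Lemma extend_cls s : extend_hom (mcls s) = meval s.
Proof. exact: (@lift_cls D free_pre M meval meval_mono). Qed.

Lemma extend1 : extend_hom mone = mone.
Proof. exact: extend_cls. Qed.
Lemma extendM x y : extend_hom (mmul x y) = mmul (extend_hom x) (extend_hom y).
Proof. exact: extend_cls. Qed.

(* h^+ : X^* -> M *)
Definition extend : mhom free_monoid M := MHom extend1 extendM.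

Lemma extend_unit x : extend (free_unit x) = h x.
Proof. exact: extend_cls. Qed.
End Extend.

Lemma extend_unique (M : dmonoid D) (f g : mhom free_monoid M) :
  (forall x, f (free_unit x) = g (free_unit x)) -> f = g.
Proof.
move=> fg; apply: mhom_ext => q; have [s ->] := mclsP q.
elim: s => [x|o a IH||s IHs t IHt].
- exact: fg.
- rewrite -free_op_cls (proj2 (homP f)) (proj2 (homP g)).
  by congr (op o _); apply: funext => i; apply: IH.
- by rewrite [LHS](mhom1 f) [RHS](mhom1 g).
- by rewrite -free_mul_cls [LHS](mhomM f) [RHS](mhomM g) IHs IHt.
Qed.
End FreeMonoid.

(* Image of a D-monoid morphism: the submonoid of its values, with the order   *)
(* inherited from the codomain.                                                *)
Section Image.
Variables (D : comm_variety) (M N : dmonoid D) (f : mhom M N).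

Record image_car := ImageElt {
  ival : N;
  ivalP : exists x, f x = ival
}.

Lemma ival_inj : injective ival.
Proof.
case=> [x px] [y py] /= E; case: _ / E in py *.
by rewrite (Prop_irrelevance px py).
Qed.

Lemma image_op_subproof o (a : 'I_(arity o) -> image_car) :
  exists x, f x = op o (fun i => ival (a i)).
Proof.
have [b bE] := choice (fun i => ivalP (a i)).
exists (op o b); rewrite (proj2 (homP f)); congr (op o _).
exact: funext.
Qed.
Definition image_op : raw_ops (vsig D) image_car :=
  fun o a => ImageElt (image_op_subproof a).
Definition image_le (x y : image_car) : Prop := le (ival x) (ival y).

Lemma image_le_refl x : image_le x x. Proof. exact: le_refl. Qed.
Lemma image_le_trans x y z : image_le x y -> image_le y z -> image_le x z.
Proof. exact: le_trans. Qed.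
Lemma image_le_anti x y : image_le x y -> image_le y x -> x = y.
Proof. by move=> xy yx; apply: ival_inj; apply: le_anti. Qed.
Lemma image_le_discrete :
  vkind D = Unordered -> forall x y, image_le x y -> x = y.
Proof. by move=> k x y xy; apply: ival_inj; apply: le_discrete. Qed.
Lemma image_op_mono o (a b : 'I_(arity o) -> image_car) :
  (forall i, image_le (a i) (b i)) -> image_le (image_op a) (image_op b).
Proof. by move=> ab; apply: op_mono. Qed.
Lemma image_op_sat s t : vax s t ->
  forall v : nat -> image_car, image_le (eval image_op v s) (eval image_op v t).
Proof.
move=> st v; rewrite /image_le.
by rewrite !(eval_morph (h := ival) (ops' := @op D N)) //; apply: op_sat.
Qed.

Definition image_obj : algebra D :=
  Algebra image_le_refl image_le_trans image_le_anti image_le_discrete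
          image_op_mono image_op_sat.

Definition image_one : image_obj := ImageElt (ex_intro _ mone (mhom1 f)).

Lemma image_mul_subproof (x y : image_obj) :
  exists z, f z = mmul (ival x) (ival y).
Proof.
have [[a ax] [b bY]] := (ivalP x, ivalP y).
by exists (mmul a b); rewrite mhomM ax bY.
Qed.
Definition image_mul (x y : image_obj) : image_obj :=
  ImageElt (image_mul_subproof x y).

Lemma image_mul_bimorphism : bimorphism image_mul.
Proof.
have [mr ml] := mmul_bimorphism N.
split=> x; split=> [y z yz|o a].
- exact: (proj1 (mr _)).
- by apply: ival_inj; rewrite /= (proj2 (mr _)).
- exact: (proj1 (ml _)).
- by apply: ival_inj; rewrite /= (proj2 (ml _)).
Qed.
Lemma image_mulA x y z :
  image_mul x (image_mul y z) = image_mul (image_mul x y) z.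
Proof. by apply: ival_inj; apply: mmulA. Qed.
Lemma image_mul1l x : image_mul image_one x = x.
Proof. by apply: ival_inj; apply: mmul1l. Qed.
Lemma image_mul1r x : image_mul x image_one = x.
Proof. by apply: ival_inj; apply: mmul1r. Qed.

Definition image : dmonoid D :=
  DMonoid image_mul_bimorphism image_mulA image_mul1l image_mul1r.
End Image.

Section Automata.
Variables (D : comm_variety) (X Y : algebra D).

Record automaton := Automaton {
  state : algebra D;
  delta : hom (tensor X state) state;
  init : hom (unit_alg D) state;
  final : hom state Y
}.

(* w |-> delta_w, with delta_(v w) = delta_v \o delta_w *)
Definition dplus (A : automaton) : mhom (free_monoid X) (endo (state A)) :=
  extend (M := endo (state A)) (curry (delta A)).

(* w |-> f (delta_w q) *)
Definition lang_from (A : automaton) (q : state A) : hom (free_monoid X) Y :=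
  hcomp (final A) (hcomp (ev (state A) q) (dplus A)).

Definition accepted (A : automaton) : hom (free_monoid X) Y :=
  lang_from (elem (init A)).

Definition reachable (A : automaton) : Prop :=
  surj (fun w : free_monoid X => ev (state A) (elem (init A)) (dplus A w)).

(* In the ordered case an injective but not order-reflecting map would not     *)
(* determine the order on states, and minimal automata would not be unique.    *)
Definition simple (A : automaton) : Prop :=
  embedding (B := ihom (free_monoid X) Y) (@lang_from A).

Definition minimal (A : automaton) : Prop := reachable A /\ simple A.

Definition transition_monoid (A : automaton) : dmonoid D := image (dplus A).

Record xgen_monoid := XGenMonoid {
  xmon :> dmonoid D;
  xmap : mhom (free_monoid X) xmon;
  xmap_surj : surj xmap
}.

Definition recognizes (M : dmonoid D) (e : mhom (free_monoid X) M)
    (L : hom (free_monoid X) Y) : Prop :=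
  exists g : hom M Y, L = hcomp g e.

Definition xgen_le (M1 M2 : xgen_monoid) : Prop :=
  exists h : mhom M2 M1, forall w, xmap M1 w = h (xmap M2 w).

Definition is_syntactic (L : hom (free_monoid X) Y) (S : xgen_monoid) : Prop :=
  recognizes (xmap S) L /\
  forall M : xgen_monoid, recognizes (xmap M) L -> xgen_le S M.
End Automata.

(* Main.v *)
Set Warnings "-notation-overridden".
From mathcomp Require Import all_boot.
From mathcomp Require Import boolp.
Require Import Defs.

Set Implicit Arguments.
Unset Strict Implicit.
Unset Printing Implicit Defensive.

(* The X-generated monoid T(Min(L)) recognizes L through t |-> f(t(i)), and it *)
(* lies below every X-generated e : X^* -> M recognizing L, say L = g \o e:    *)
(* if e u <= e v then delta_u <= delta_v.  Indeed each state is delta_w(i) by  *)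
(* reachability, and the language of delta_u(delta_w(i)) is                    *)
(* x |-> L(x u w) = g(e x * e u * e w), so simplicity gives the inequality of  *)
(* states.  Hence T(Min(L)) and Syn(L) lie below each other.                   *)

(** Treats both kinds of variety at once: where the order is equality, injectivity already reflects
    it. *)
Lemma embedding_reflects (D : variety) (A B : algebra D) (f : A -> B) x y :
  embedding f -> le (f x) (f y) -> le x y.
Proof.
case=> fI fO; case Dk: (vkind D) => fxy; last exact: fO.
by rewrite (fI x y (le_discrete Dk fxy)); apply: le_refl.
Qed.

(** The homomorphism theorem for ordered monoids: [h] is [f] after a set-theoretic section [s] of
    [e]. *)
Lemma surj_mhom_factor (D : comm_variety) (M N P : dmonoid D)
    (e : mhom M N) (f : mhom M P) :
  surj e -> (forall x y, le (e x) (e y) -> le (f x) (f y)) ->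
  exists h : mhom N P, forall x, h (e x) = f x.
Proof.
move=> eS ef; have [s sK] := choice eS; pose h y := f (s y).
have hE x : h (e x) = f x.
  (* Since [e (s (e x)) = e x], the hypothesis applies in both directions. *)
  by apply: le_anti; apply: ef; rewrite sK; apply: le_refl.
have h_hom : is_hom h.
  split=> [y z yz|o a]; first by apply: ef; rewrite !sK.
  rewrite -(proj2 (homP f)) -hE (proj2 (homP e)); congr (h (op o _)).
  by apply: funext => i; rewrite sK.
have h1 : h mone = mone by rewrite -(mhom1 e) hE mhom1.
have hM y z : h (mmul y z) = mmul (h y) (h z).
  by rewrite -mhomM -hE mhomM !sK.
by exists (@MHom D N P (Hom h_hom) h1 hM).
Qed.

(** Both comparison morphisms commute with the surjections from [X^*], so their composites fix every
    element. *)
Lemma xgen_le_anti (D : comm_variety) (X : algebra D) (M N : xgen_monoid X) :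
  xgen_le M N -> xgen_le N M -> mon_iso M N.
Proof.
move=> [h hE] [k kE]; exists k, h; split=> z.
  by have [w <-] := xmap_surj z; rewrite -kE -hE.
by have [w <-] := xmap_surj z; rewrite -hE -kE.
Qed.

Section Corestriction.
Variables (D : comm_variety) (M N : dmonoid D) (f : mhom M N).

Definition corestr_fun (x : M) : image f := ImageElt (ex_intro _ x erefl).

Lemma corestr_is_hom : is_hom corestr_fun.
Proof.
split=> [x y|o a]; first exact: (proj1 (homP f)).
by apply: ival_inj; apply: (proj2 (homP f)).
Qed.

Lemma corestr1 : Hom corestr_is_hom mone = mone.
Proof. by apply: ival_inj; apply: mhom1. Qed.

Lemma corestrM x y : Hom corestr_is_hom (mmul x y) =
  mmul (Hom corestr_is_hom x) (Hom corestr_is_hom y).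
Proof. by apply: ival_inj; apply: mhomM. Qed.

Definition corestr : mhom M (image f) := MHom corestr1 corestrM.

Lemma corestr_surj : surj corestr.
Proof. by move=> [y [x fx]]; exists x; apply: ival_inj. Qed.

Lemma ival_is_hom : is_hom (fun y : image f => ival y : N).
Proof. by []. Qed.
End Corestriction.

Section TransitionMonoid.
Variables (D : comm_variety) (X Y : algebra D) (A : automaton X Y).

Definition transition_xgen : xgen_monoid X :=
  XGenMonoid (@corestr_surj D _ _ (dplus A)).

Lemma transition_recognizes : recognizes (xmap transition_xgen) (accepted A).
Proof.
exists (hcomp (final A)
  (hcomp (ev (state A) (elem (init A))) (Hom (@ival_is_hom D _ _ (dplus A))))).
exact: hom_ext.
Qed.

Lemma lang_from_dplus u w x :
  lang_from (dplus A u (dplus A w (elem (init A)))) x =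
  accepted A (mmul x (mmul u w)).
Proof.
by rewrite -[RHS]/(final A (dplus A (mmul x (mmul u w)) _)) !mhomM.
Qed.

Lemma transition_le (M : xgen_monoid X) :
  minimal A -> recognizes (xmap M) (accepted A) -> xgen_le transition_xgen M.
Proof.
move=> [reach simp] [g gE].
(* The image inherits its order from the endomorphisms, so this is the factorization criterion for
   [corestr (dplus A)]. *)
suff dle u v : le (xmap M u) (xmap M v) -> le (dplus A u) (dplus A v).
  have [h hE] := surj_mhom_factor (f := corestr (dplus A)) (@xmap_surj _ _ M) dle.
  by exists h => w; rewrite hE.
(* Endomorphisms are ordered pointwise, and simplicity lets states be compared through their
   languages. *)
move=> uv q; have [w <-] := reach q; apply: (embedding_reflects simp) => x.
have [mr ml] := mmul_bimorphism M.
rewrite !lang_from_dplus gE -![hcomp _ _ _]/(g (xmap M _)) !mhomM.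
by apply: (proj1 (homP g)); apply: (proj1 (mr _)); apply: (proj1 (ml _)).
Qed.
End TransitionMonoid.

Theorem theorem4p7 (D : comm_variety) (X Y : algebra D)
    (L : hom (free_monoid X) Y)
    (SynL : xgen_monoid X) (MinL : automaton X Y) :
  is_syntactic L SynL ->
  minimal MinL -> accepted MinL = L ->
  mon_iso SynL (transition_monoid MinL).
Proof.
move=> synL minA E; case: _ / E in synL *; case: synL => synL syn_min.
apply: (xgen_le_anti (N := transition_xgen MinL)).
  exact/syn_min/transition_recognizes.
exact: transition_le.
Qed.
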